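(* Let $D$ and $r$ be positive integers with $D \geq 2$. There exists a rooted tree $T_r^D$ such that every $D$-distinguishable tree of radius at most $r$ is isomorphic to a branched subgraph of $T_r^D$. Further, if $r \geq 2$, this tree $T_r^D$ has the property that every branched subgraph of $T_r^D$ having radius $r$ is $D$-distinguishable.
   Context: Graphs are finite and simple; a tree is a connected graph without cycles. The eccentricity of a vertex $v$ in a connected graph $G$ is $\max_{w \in V(G)} \mathrm{dist}(v,w)$, and the radius of $G$ is the minimum eccentricity of a vertex of $G$. A graph $G$ is $D$-distinguishable if there is a (not necessarily proper) coloring of its vertices using at most $D$ colors such that the only automorphism of $G$ preserving the color of every vertex is the identity; here automorphisms of (and isomorphisms between) trees are those of the underlying unrooted graphs. Let $T$ be a rooted tree with root $x$. The branches of $T$ are the maximal subtrees of $T$ that contain $x$ as a leaf (there are $\deg(x)$ of them, one for each neighbor of $x$). A branched subgraph of $T$ is any union of a nonempty collection of branches of $T$, or the one-vertex subtree consisting only of $x$. *)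

(* Defs.v *)
From HB Require Import structures.
From mathcomp Require Import all_boot.

Set Implicit Arguments.
Unset Strict Implicit.
Unset Printing Implicit Defensive.

Record sgraph := SGraph {
  vertex :> finType;
  edge : rel vertex;
  edge_sym : symmetric edge;
  edge_irrefl : irreflexive edge }.

Arguments edge {s} u v.

Definition isomorphism (G H : sgraph) (f : G -> H) : Prop :=
  bijective f /\ {mono f : u v / edge u v}.

Definition isomorphic (G H : sgraph) : Prop :=
  exists f : G -> H, isomorphism f.

Definition connected (G : sgraph) : Prop :=
  0 < #|G| /\ forall u v : G, connect edge u v.

(* A two-element sequence [:: u; v] of adjacent vertices is a ucycle in the
   sense of path.v, hence the length condition. *)
Definition acyclic (G : sgraph) : Prop :=
  forall p : seq G, 2 < size p -> ~ ucycle edge p.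

Definition is_tree (G : sgraph) : Prop := connected G /\ acyclic G.

(* Least length of a walk from u to v; it is #|G| if there is none, and less
   than #|G| otherwise. *)
Definition dist (G : sgraph) (u v : G) : nat :=
  find (fun n => [exists p : n.-tuple G, path edge u p && (last u p == v)])
       (iota 0 #|G|).

Definition eccentricity (G : sgraph) (v : G) : nat := \max_(w : G) dist v w.

(* The neutral value #|G| bounds every eccentricity, so for nonempty G this is
   the minimum of the eccentricities. *)
Definition radius (G : sgraph) : nat :=
  \big[minn/#|G|]_(v : G) eccentricity v.

Definition distinguishable (D : nat) (G : sgraph) : Prop :=
  exists c : G -> 'I_D, forall f : G -> G,
    isomorphism f -> (forall v, c (f v) = c v) -> forall v, f v = v.

Section Induced.
Variables (G : sgraph) (S : {set G}).

Definition induced_edge : rel {v : G | v \in S} :=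
  fun u v => edge (val u) (val v).

Lemma induced_edge_sym : symmetric induced_edge.
Proof. by move=> u v; apply: edge_sym. Qed.

Lemma induced_edge_irrefl : irreflexive induced_edge.
Proof. by move=> u; apply: edge_irrefl. Qed.

Definition induced : sgraph := SGraph induced_edge_sym induced_edge_irrefl.
End Induced.

(* A connected subgraph of a tree T is an induced subgraph, and so is a union
   of branches at x, since no edge joins two branches outside x.  Hence these
   subgraphs of T are represented by their vertex sets. *)
Definition leaf_subtree (T : sgraph) (x : T) (S : {set T}) : Prop :=
  [/\ is_tree (induced S), x \in S & #|[set w in S | edge x w]| = 1].

Definition branch (T : sgraph) (x : T) (B : {set T}) : Prop :=
  leaf_subtree x B /\
  forall S : {set T}, leaf_subtree x S -> B \subset S -> S = B.

Definition branched_subgraph (T : sgraph) (x : T) (S : {set T}) : Prop :=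
  S = [set x] \/
  exists F : {set {set T}},
    [/\ F != set0, forall B, B \in F -> branch x B & S = cover F].

(* Main.v *)
Require Import Defs.
From HB Require Import structures.
From mathcomp Require Import all_boot.
From mathcomp Require Import zify.

Set Implicit Arguments.
Unset Strict Implicit.
Unset Printing Implicit Defensive.

(** Fix a root in a tree and color the vertices. If the coloring is rigid, that
    is, only the identity preserves it, then two children of the same vertex
    never carry isomorphic colored subtrees, since these could be exchanged. So
    a rigid colored rooted tree of height at most [h] amounts to a color of the
    root together with a set, not a multiset, of rigid colored rooted trees of
    height less than [h]: there are finitely many of them, and they can be coded
    by natural numbers in the manner of Ackermann, with the color as remainder
    modulo [D] and the set of subcodes as the bits of the quotient
    ([subcode], [mkcode], [code_ext]).

    The universal tree is the tree that unfolds the set of all codes of height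
    less than [r]. Its vertices are the words of codes, deepest letter first, in
    which each letter is a subcode of the next one; the empty word is the root
    and the parent of a word is its tail.

    A [D]-distinguishable tree of radius at most [r] has a vertex of
    eccentricity at most [r]. Take it as the root and send each vertex to the
    word of the codes met on its way up. As siblings have different codes
    ([distinguishing_sibling_injective]), this is injective, and its image is a
    branched subgraph ([distinguishable_embeds]).

    Conversely, color each vertex of a branched subgraph by the color of its
    first letter. An automorphism that fixes the root and preserves this
    coloring preserves the codes, by induction from the leaves, hence the words
    ([coding_rigid]). This leaves the color of the root free to be chosen. When
    the radius is [r], a vertex other than the root to which an automorphism can
    move the root is a second center, and there is at most one such vertex
    ([center_unique]); coloring the root differently from it forces the root to
    be fixed, which is possible because there are two colors
    ([distinguishable_from_root]). *)

(** * Distances and cycles *)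

Section Distance.
Variable G : sgraph.
Implicit Types (u v w : G) (p : seq G).

Lemma dist_le_walk u p : path edge u p -> dist u (last u p) <= size p.
Proof.
move=> up; rewrite /dist leqNgt; apply/negP => lt_p.
have := before_find 0 lt_p.
rewrite nth_iota ?add0n; last first.
  by apply: leq_trans lt_p _; rewrite -[X in _ <= X](size_iota 0) find_size.
move/negbT/negP; apply; apply/existsP; exists (in_tuple p).
by rewrite /= up eqxx.
Qed.

Lemma dist_walk u v :
  connect edge u v -> exists p, [/\ path edge u p, last u p = v & size p = dist u v].
Proof.
case/connectP => p0 up0 ->; case/shortenP: up0 => p up uniq_p _.
set P := fun n => [exists q : n.-tuple G, path edge u q && (last u q == last u p)].
have : has P (iota 0 #|G|).
  apply/hasP; exists (size p).
    by rewrite mem_iota /= add0n; have := max_card (mem (u :: p)); rewrite (card_uniqP uniq_p).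
  by apply/existsP; exists (in_tuple p); rewrite /= up eqxx.
move=> hasP; have := nth_find 0 hasP; rewrite has_find size_iota in hasP.
rewrite nth_iota // add0n => /existsP[q /andP[uq /eqP qv]].
by exists q; rewrite uq qv size_tuple.
Qed.

Lemma dist_refl u : dist u u = 0.
Proof. by apply/eqP; rewrite -leqn0; apply: (@dist_le_walk u [::]). Qed.

Lemma dist_le_card u v : dist u v <= #|G|.
Proof. by rewrite -[X in _ <= X](size_iota 0) find_size. Qed.

Lemma dist_le_edge u v w :
  connect edge v w -> edge u v -> dist u w <= (dist v w).+1.
Proof.
move=> /dist_walk[p [vp <- <-]] uv.
by apply: (@dist_le_walk u (v :: p)); rewrite /= uv.
Qed.

Lemma dist_le_eccentricity u v : dist u v <= eccentricity u.
Proof. exact: leq_bigmax. Qed.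

Lemma radius_le_eccentricity u : radius G <= eccentricity u.
Proof.
rewrite /radius; elim: (index_enum G) (mem_index_enum u) => //= v s IH.
rewrite big_cons inE => /predU1P[<-|/IH us]; first exact: geq_minl.
exact: leq_trans (geq_minr _ _) us.
Qed.

Lemma eccentricity_le_radius :
  0 < #|G| -> exists u, eccentricity u <= radius G.
Proof.
case/card_gt0P => u0 _; rewrite /radius.
elim/big_ind: _ => [|m n [u um] [v vn]|u _]; last by exists u.
  by exists u0; apply/bigmax_leqP => v _; apply: dist_le_card.
by case: (leqP m n) => mn; [exists u|exists v].
Qed.

Lemma eccentricity_isomorphism (f : G -> G) u :
  connected G -> isomorphism f -> eccentricity (f u) <= eccentricity u.
Proof.
move=> [_ conG] [[g fK gK] fe]; apply/bigmax_leqP => w _; rewrite -(gK w).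
apply: leq_trans (dist_le_eccentricity u (g w)).
have [p [up <- <-]] := dist_walk (conG u (g w)).
rewrite -last_map -(size_map f); apply: dist_le_walk.
by rewrite path_map; apply: sub_path up => a b; rewrite /= fe.
Qed.

(** Otherwise a simple path from [v] to [w] avoiding [u] would close up to a cycle
    through [u]. *)
Lemma acyclic_neighbors_separated u v w :
  acyclic G -> edge u v -> edge u w ->
  connect [rel a b | [&& edge a b, a != u & b != u]] v w -> v = w.
Proof.
move=> acG uv uw /connectP[p0 vp0 ew]; move: uw; rewrite {}ew.
case/shortenP: vp0 => [[|b p] vp uniq_p _ uw] //; case: (acG [:: u, v, b & p]) => //.
have [vp' u_p] : path edge v (b :: p) /\ u \notin v :: b :: p.
  have vu : v != u by apply: contraTneq uv => ->; rewrite edge_irrefl.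
  elim: (b :: p) (v) vu vp {uniq_p uw uv} => [|a q IH] z zu //=.
    by rewrite inE eq_sym zu.
  case/andP=> /and3P[za _ au] aq; have [-> uq] := IH a au aq.
  by rewrite za inE negb_or eq_sym zu.
apply/andP; split; last by rewrite cons_uniq u_p.
rewrite /cycle -cat1s rcons_path; apply/andP; split; last by rewrite /= edge_sym.
by rewrite [path _ _ _]/= uv.
Qed.

End Distance.

(** * Rooted trees *)

(** The data of a parent function and a depth function that describe all edges;
    it is used both for trees seen from a vertex and for trees of words. That
    [v] lies below [a] is written [fconnect par v a]. *)
Definition rooting (G : sgraph) (x : G) (par : G -> G) (dep : G -> nat) : Prop :=
  [/\ dep x = 0, par x = x,
      forall u, u != x -> dep u = (dep (par u)).+1
    & forall u w, edge u w = (u != x) && (par u == w) || (w != x) && (par w == u)].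

Section Rooting.
Variables (G : sgraph) (x : G) (par : G -> G) (dep : G -> nat).
Hypothesis rootG : rooting x par dep.
Implicit Types (u v w a b : G) (S : {set G}).

Let dep_root : dep x = 0. Proof. by case: rootG. Qed.
Let par_root : par x = x. Proof. by case: rootG. Qed.
Let dep_par u : u != x -> dep u = (dep (par u)).+1.
Proof. by case: rootG => _ _ + _; apply. Qed.
Let edgeE u w :
  edge u w = (u != x) && (par u == w) || (w != x) && (par w == u).
Proof. by case: rootG. Qed.

Lemma edge_par u : u != x -> edge u (par u).
Proof. by move=> ux; rewrite edgeE ux eqxx. Qed.

Lemma rooting_ind (P : G -> Prop) :
  P x -> (forall u, u != x -> P (par u) -> P u) -> forall u, P u.
Proof.
move=> Px Ppar u; have [n] := ubnP (dep u); elim: n u => // n IH u.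
have [->//|ux] := eqVneq u x.
by rewrite (dep_par ux) ltnS => /IH; apply: Ppar.
Qed.

Lemma dep_edge u w : edge u w -> dep w <= (dep u).+1.
Proof.
rewrite edgeE => /orP[]/andP[/dep_par dE /eqP parE]; rewrite dE parE //.
by rewrite !leqW.
Qed.

Lemma dep_path u p : path edge u p -> dep (last u p) <= dep u + size p.
Proof.
elim: p u => [|w p IH] u /=; first by rewrite addn0.
by case/andP => /dep_edge uw /IH; lia.
Qed.

Lemma connect_root u : connect edge u x.
Proof.
elim/rooting_ind: u => // u ux; apply: connect_trans.
exact: connect1 (edge_par ux).
Qed.

(** A deepest vertex of a cycle could only have its parent as a neighbor on the
    cycle, but it has two of them. *)
Lemma rooting_tree : is_tree G.
Proof.
split.
  split; first by apply/card_gt0P; exists x.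
  move=> u v; apply: connect_trans (connect_root u) _.
  by rewrite (sym_connect_sym (@edge_sym G)) connect_root.
move=> p sz_p cyc_p.
have [u0 u0p] : exists u, u \in p by case: (p) sz_p => // u q; exists u; exact: mem_head.
case: (arg_maxnP dep u0p) => m mp max_m.
have [i q def_q] := rot_to mp.
have {}max_m w : w \in m :: q -> dep w <= dep m.
  by rewrite -def_q mem_rot => /max_m.
(* The cycle is rotated so that it starts at its deepest vertex [m]. *)
move: cyc_p sz_p; rewrite -(rot_ucycle i) -(size_rot i) def_q => /andP[].
have up w : w \in m :: q -> edge m w -> w = par m.
  move=> /max_m; rewrite edgeE leqNgt => le_w /orP[/andP[_ /eqP//]|].
  by case/andP=> /dep_par dw /eqP wm; rewrite dw wm ltnSn in le_w.
case/lastP: q {def_q max_m} up => // q c up.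
rewrite /cycle rcons_path last_rcons => /andP[+ cm] uniq_q.
case: q up uniq_q => // b q up uniq_q /= /andP[mb _] _.
have eb : b = par m by apply: up => //; rewrite !inE eqxx orbT.
have ec : c = par m.
  by apply: up; rewrite 1?edge_sym // -rcons_cons mem_rcons mem_head.
by move: uniq_q; rewrite /= eb ec mem_rcons mem_head andbF.
Qed.

Lemma par_fconnectE u a : fconnect par u a = (u == a) || fconnect par (par u) a.
Proof.
apply/idP/orP => [/connectP[[|w p] /=]|[/eqP->//|]].
- by move=> _ ->; left.
- by case/andP=> /eqP-> wp ->; right; apply/connectP; exists p.
- exact: connect_trans (fconnect1 par u).
Qed.

Lemma root_fconnect a : fconnect par x a = (x == a).
Proof.
apply/idP/eqP => [/connectP[p]|->//]; elim: p => [|w p IH] //=.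
by rewrite par_root; case/andP => /eqP <-.
Qed.

Lemma dep_fconnect u a : fconnect par u a -> dep a <= dep u ?= iff (u == a).
Proof.
elim/rooting_ind: u => [|u ux IH].
  by rewrite root_fconnect => /eqP->; split; rewrite ?eqxx.
rewrite par_fconnectE; have [->|ua] /= := eqVneq u a.
  by move=> _; split; rewrite ?eqxx.
by move=> /IH[+ _]; rewrite (dep_par ux) => le_a; split; [lia | apply/eqP; lia].
Qed.

Lemma fconnect_child u a b :
  fconnect par u a -> fconnect par u b -> dep a = dep b -> a = b.
Proof.
elim/rooting_ind: u => [|u ux IH].
  by rewrite !root_fconnect => /eqP <- /eqP.
move=> fa fb ab; have [ua|ua] := eqVneq u a.
  by apply/eqP; rewrite -ua -(eq_leqif (dep_fconnect fb)) -ab ua.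
have [ub|ub] := eqVneq u b.
  by apply/esym/eqP; rewrite -ub -(eq_leqif (dep_fconnect fa)) ab ub.
by apply: IH ab; [move: fa|move: fb]; rewrite par_fconnectE ?(negbTE ua) ?(negbTE ub).
Qed.

Lemma top_ancestor u :
  u != x -> exists a, [/\ a != x, par a = x & fconnect par u a].
Proof.
elim/rooting_ind: u => [|u ux IH _]; first by rewrite eqxx.
have [pux|/IH[a [ax pa ua]]] := eqVneq (par u) x; first by exists u.
by exists a; split=> //; rewrite par_fconnectE ua orbT.
Qed.

Lemma dep_child a : a != x -> par a = x -> dep a = 1.
Proof. by move=> /dep_par-> ->; rewrite dep_root. Qed.

Lemma edge_root a : edge x a = (a != x) && (par a == x).
Proof. by rewrite edgeE eqxx. Qed.

Section ParentClosed.
Variables (S : {set G}) (xS : x \in S).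
Hypothesis parS : forall u, u \in S -> par u \in S.

Definition induced_root : induced S := Sub x xS.
Definition induced_par (u : induced S) : induced S := Sub (par (val u)) (parS (valP u)).

Lemma induced_rooting : rooting induced_root induced_par (dep \o val).
Proof.
split=> [|||u w].
- exact: dep_root.
- exact/val_inj/par_root.
- by move=> u ux; apply: dep_par.
- by rewrite [LHS]edgeE.
Qed.

End ParentClosed.

End Rooting.

(** * Branches *)

Section Branches.
Variables (G : sgraph) (x : G) (par : G -> G) (dep : G -> nat).
Hypothesis rootG : rooting x par dep.
Implicit Types (u v w a b : G) (S : {set G}).

Let par_root : par x = x. Proof. by case: rootG. Qed.
Let edgeE u w :
  edge u w = (u != x) && (par u == w) || (w != x) && (par w == u).
Proof. by case: rootG. Qed.

Definition hanging_branch a : {set G} := x |: [set u | fconnect par u a].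

Lemma leaf_subtree_hanging_branch a :
  a != x -> par a = x -> leaf_subtree x (hanging_branch a).
Proof.
move=> ax pa; have xB : x \in hanging_branch a by rewrite !inE eqxx.
split=> //.
  apply: rooting_tree (induced_rooting rootG xB _) => u.
  rewrite !inE par_fconnectE => /predU1P[->|/predU1P[->|->]];
    by rewrite ?par_root ?pa ?eqxx ?orbT.
apply/eqP/cards1P; exists a; apply/setP => w; rewrite !inE (edge_root rootG).
have [->|wx] := eqVneq w x; first by rewrite andbF eq_sym (negbTE ax).
have [->|wa] /= := eqVneq w a; first by rewrite pa connect0 eqxx.
apply/andP => -[+ /eqP pw]; rewrite par_fconnectE (negbTE wa) pw.
by rewrite (root_fconnect rootG) eq_sym (negbTE ax).
Qed.

(** Let [a] be the only neighbor of the root in [S]. A vertex of [S] is joined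
    to the root within [S], and one leaves the branch of another child [b] of
    the root only through [b], which is not in [S]. *)
Lemma leaf_subtree_sub S :
  leaf_subtree x S -> exists a, [/\ a != x, par a = x & S \subset hanging_branch a].
Proof.
case=> -[[_ conS] _] xS /eqP/cards1P[a /setP eSa].
have := eSa a; rewrite !inE (edge_root rootG) eqxx => /and3P[aS ax /eqP pa].
exists a; split=> //; apply/subsetP => u uS; rewrite !inE.
have [//|/= /(top_ancestor rootG)[b [bx pb ub]]] := eqVneq u x.
have [bS|bS] := boolP (b \in S).
  by have := eSa b; rewrite !inE (edge_root rootG) bS bx pb eqxx => /esym/eqP <-.
pose P := [pred v : induced S | fconnect par (val v) b].
have clP : closed edge P.
  apply: intro_closed; first exact/sym_connect_sym/edge_sym.
  move=> v w; rewrite [edge _ _]edgeE !inE => /orP[]/andP[vx /eqP pvw].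
    rewrite par_fconnectE pvw => /predU1P[vb|//].
    by move: bS; rewrite -vb (valP v).
  by rewrite (par_fconnectE par (val w)) pvw orbC => ->.
have := closed_connect clP (conS (Sub u uS) (Sub x xS)).
by rewrite !inE /= ub (root_fconnect rootG) eq_sym (negbTE bx).
Qed.

Lemma branchE B :
  branch x B <-> exists a, [/\ a != x, par a = x & B = hanging_branch a].
Proof.
split=> [[leafB maxB]|[a [ax pa ->]]].
  have [a [ax pa Ba]] := leaf_subtree_sub leafB; exists a; split=> //.
  by rewrite (maxB (hanging_branch a)) //; apply: leaf_subtree_hanging_branch.
split; first exact: leaf_subtree_hanging_branch.
move=> S leafS aS; have [b [bx pb Sb]] := leaf_subtree_sub leafS.
suff eab : b = a by apply/eqP; rewrite eqEsubset aS -eab Sb.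
have : a \in hanging_branch b.
  by apply: (subsetP Sb); apply: (subsetP aS); rewrite !inE connect0 orbT.
rewrite !inE (negbTE ax) par_fconnectE pa (root_fconnect rootG).
by rewrite eq_sym (eq_sym x) (negbTE bx) orbF => /eqP.
Qed.

Lemma hanging_branch_par a u :
  par a = x -> par u != x -> (u \in hanging_branch a) = (par u \in hanging_branch a).
Proof.
move=> pa pux; rewrite !inE (negbTE pux) (par_fconnectE par u a).
have [ux|_] /= := eqVneq u x; first by rewrite ux par_root eqxx in pux.
by case: (eqVneq u a) pux => [->|//]; rewrite pa eqxx.
Qed.

(** This local form of the definition is the one used below: a branched subgraph
    may drop children of the root, but contains a vertex below one of them
    exactly when it contains the parent. *)
Lemma branched_subgraphE S :
  branched_subgraph x S <->
  x \in S /\ (forall u, par u != x -> (u \in S) = (par u \in S)).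
Proof.
split=> [[->|[F [F0 brF ->]]]|[xS parS]].
- split=> [|u pux]; rewrite !inE ?eqxx // (negbTE pux).
  by apply: contraNF pux => /eqP->; rewrite par_root.
- split.
    have /set0Pn[B FB] := F0; apply/bigcupP; exists B => //.
    by case: (brF B FB) => -[].
  move=> u pux.
  have parB B : B \in F -> (u \in B) = (par u \in B).
    by move=> /brF/branchE[a [ax pa ->]]; apply: hanging_branch_par.
  by apply/bigcupP/bigcupP => -[B FB uB]; exists B => //; rewrite ?parB // -parB.
pose A := [set a in S | (a != x) && (par a == x)].
have topS u a : a != x -> par a = x -> fconnect par u a -> (u \in S) = (a \in S).
  move=> ax pa; elim/(rooting_ind rootG): u => [|u ux IH].
    by rewrite (root_fconnect rootG) eq_sym (negbTE ax).
  rewrite par_fconnectE => /predU1P[->//|pua]; rewrite -IH // parS //.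
  by apply: contraTneq pua => ->; rewrite (root_fconnect rootG) eq_sym.
have topA u : u \in S -> u != x -> exists2 a, a \in A & fconnect par u a.
  move=> uS /(top_ancestor rootG)[a [ax pa ua]]; exists a => //.
  by rewrite inE -(topS u) // uS ax pa eqxx.
have [A0|/set0Pn[a0 Aa0]] := eqVneq A set0.
  left; apply/setP => u; rewrite inE; have [->//|ux] := eqVneq u x.
  by apply/negP => /topA/(_ ux)[a]; rewrite A0 inE.
right; exists (hanging_branch @: A); split.
- by apply/set0Pn; exists (hanging_branch a0); apply: imset_f.
- move=> B /imsetP[a]; rewrite inE => /and3P[_ ax /eqP pa] ->.
  by apply/branchE; exists a.
apply/setP => u; apply/idP/bigcupP => [uS|[B /imsetP[a]]].
  have [->|ux] := eqVneq u x.
    by exists (hanging_branch a0); rewrite ?imset_f // !inE eqxx.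
  have [a aA ua] := topA u uS ux.
  by exists (hanging_branch a); rewrite ?imset_f // !inE ua orbT.
rewrite inE => /and3P[aS ax /eqP pa] ->; rewrite !inE => /predU1P[->//|ua].
by rewrite (topS _ _ ax pa ua).
Qed.

End Branches.

(** * Rooting a tree at a vertex *)

Section TreeRooting.
Variables (G : sgraph) (x : G).
Hypothesis treeG : is_tree G.
Implicit Types (u v w : G).

Let conG u v : connect edge u v. Proof. by case: treeG => -[_]. Qed.

Lemma dist_eq0 u : (dist x u == 0) = (u == x).
Proof.
apply/eqP/eqP => [|->]; last exact: dist_refl.
by have [[|v p] [_ <- <-]] := dist_walk (conG x u).
Qed.

Lemma dist_edge u w : edge u w -> dist x w <= (dist x u).+1.
Proof.
move=> uw; have [p [xp lp <-]] := dist_walk (conG x u).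
have xw : path edge x (rcons p w) by rewrite rcons_path xp lp.
by have := dist_le_walk xw; rewrite last_rcons size_rcons.
Qed.

Lemma dist_pred u : u != x -> exists2 w, edge u w & dist x u = (dist x w).+1.
Proof.
have [p [xp <- sz]] := dist_walk (conG x u).
case/lastP: p xp sz => [|p v]; first by rewrite eqxx.
rewrite rcons_path last_rcons size_rcons => /andP[xp pv] sz _.
exists (last x p); first by rewrite edge_sym.
by apply/eqP; rewrite eqn_leq dist_edge // -sz ltnS dist_le_walk.
Qed.

(** Both neighbors reach [x] along vertices other than [u], since shortest paths
    to [x] only get closer to [x]. So the neighbors are joined off [u]. *)
Lemma closer_neighbor_unique u v w :
  edge u v -> edge u w -> dist x v <= dist x u -> dist x w <= dist x u -> v = w.
Proof.
move=> uv uw le_v le_w; apply: acyclic_neighbors_separated (uv) (uw) _.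
  by case: treeG.
have neq z : edge u z -> z != u by apply: contraTneq => ->; rewrite edge_irrefl.
set e := [rel a b | _].
have e_sym : connect_sym e.
  by apply: sym_connect_sym => a b; rewrite /= edge_sym [(a != u) && _]andbC.
have to_x z : z != u -> dist x z <= dist x u -> connect e z x.
  have [n] := ubnP (dist x z); elim: n z => // n IH z lt_n zu le_u.
  have [->//|zx] := eqVneq z x; have [t zt dt] := dist_pred zx.
  have tu : t != u by apply: contraTneq le_u => <-; rewrite dt ltnn.
  apply: connect_trans (connect1 _) (IH t _ tu _); last 2 first.
  - by rewrite dt ltnS in lt_n.
  - by rewrite dt in le_u; apply: ltnW.
  by rewrite /= zt zu tu.
by apply: connect_trans (to_x v _ _) _; rewrite ?neq // e_sym to_x ?neq.
Qed.

Lemma tree_rooting : exists par, rooting x par (dist x).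
Proof.
pose par u := odflt x [pick w | edge u w && (dist x u == (dist x w).+1)].
have parP u : u != x -> edge u (par u) /\ dist x u = (dist x (par u)).+1.
  move=> ux; rewrite /par; case: pickP => [w /andP[uw /eqP]//|].
  by have [w uw dw] := dist_pred ux => /(_ w); rewrite uw dw eqxx.
have par_eq u w : edge u w -> dist x w <= dist x u -> (u != x) && (par u == w).
  move=> uw le_w; have ux : u != x.
    apply: contraTneq le_w => eu; rewrite eu dist_refl leqn0 dist_eq0.
    by apply: contraTneq uw => ->; rewrite eu edge_irrefl.
  have [up dp] := parP u ux; rewrite ux; apply/eqP.
  by apply: closer_neighbor_unique up uw _ le_w; rewrite dp.
exists par; split=> [|||u w].
- exact: dist_refl.
- by rewrite /par; case: pickP => // w /andP[_]; rewrite dist_refl.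
- by move=> u /parP[].
apply/idP/orP => [uw|].
  have [le_w|/ltnW le_u] := leqP (dist x w) (dist x u).
    by left; apply: par_eq.
  by right; apply: par_eq; rewrite // edge_sym.
by case=> /andP[/parP[+ _] /eqP<-]; rewrite // edge_sym.
Qed.

End TreeRooting.

(** * Maps of rooted trees *)

Lemma rooting_mono (G H : sgraph) (x : G) (y : H) par dep par' dep' (f : G -> H) :
  rooting x par dep -> rooting y par' dep' -> injective f -> f x = y ->
  (forall u, par' (f u) = f (par u)) -> {mono f : u v / edge u v}.
Proof.
move=> [_ _ _ edgeG] [_ _ _ edgeH] injf fx fpar u v.
by rewrite edgeG edgeH !fpar -fx !(inj_eq injf).
Qed.

(** Going down the tree, [f u] is adjacent to [f (par u)]; it cannot be the parent
    of [f (par u)], which is already the image of the parent of [par u]. *)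
Lemma automorphism_par (G : sgraph) (x : G) par dep (f : G -> G) :
  rooting x par dep -> isomorphism f -> f x = x ->
  forall u, par (f u) = f (par u).
Proof.
move=> rootG [/bij_inj injf fe] fx; have [_ par_root dep_par edgeG] := rootG.
elim/(rooting_ind rootG) => [|u ux IH]; first by rewrite par_root fx par_root.
have := edge_par rootG ux; rewrite -fe edgeG => /orP[]/andP[fux /eqP //].
rewrite IH => /injf pu; have [e|pux] := eqVneq (par u) x.
  by rewrite e fx eqxx in fux.
by have := dep_par u ux; rewrite (dep_par _ pux) pu; lia.
Qed.

(** * Centers of a rooted tree *)

Section Center.
Variables (G : sgraph) (x : G) (par : G -> G) (dep : G -> nat).
Hypothesis rootG : rooting x par dep.
Implicit Types (u v w a b : G).

Let conG u v : connect edge u v.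
Proof. by have [[_ +] _] := rooting_tree rootG; apply. Qed.

Lemma dist_ancestor u a : fconnect par u a -> dist a u + dep a <= dep u.
Proof.
have [_ _ dep_par _] := rootG.
elim/(rooting_ind rootG): u => [|u ux IH].
  by rewrite (root_fconnect rootG) => /eqP <-; rewrite dist_refl.
rewrite par_fconnectE; have [->|ua] /= := eqVneq u a; first by rewrite dist_refl.
move=> /IH; rewrite (dep_par _ ux).
have [p [ap lp <-]] := dist_walk (conG a (par u)).
have au : path edge a (rcons p u).
  by rewrite rcons_path ap lp edge_sym (edge_par rootG).
by have := dist_le_walk au; rewrite last_rcons size_rcons; lia.
Qed.

Lemma fconnect_root u : fconnect par u x.
Proof.
elim/(rooting_ind rootG): u => // u _ ux.
exact: connect_trans (fconnect1 par u) ux.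
Qed.

(** A walk that leaves the branch of [a] climbs to the root first, and goes down to
    its end only afterwards. *)
Lemma walk_across_root a u p :
  par a = x -> fconnect par u a -> ~~ fconnect par (last u p) a ->
  path edge u p -> dep u + dep (last u p) <= size p.
Proof.
have [dep_root _ dep_par edgeG] := rootG.
move=> pa; elim: p u => [|w p IH] u ua /=; first by rewrite ua.
move=> out /andP[uw wp].
have [wa|wa] := boolP (fconnect par w a).
  by have := IH w wa out wp; have := dep_edge rootG; move=> /(_ w u); rewrite edge_sym uw; lia.
have [ux eu ew]: [/\ u != x, dep u = 1 & w = x].
  move: uw; rewrite edgeG => /orP[]/andP[ux /eqP e].
    move: ua; rewrite par_fconnectE e (negbTE wa) orbF => /eqP eua.
    by move: ux e; rewrite eua pa => ax <-; rewrite (dep_par a ax) pa dep_root.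
  by rewrite par_fconnectE e ua orbT in wa.
by have := dep_path rootG wp; rewrite ew dep_root eu; lia.
Qed.

(** Let [b] be the child of the root above a center [z]. Every vertex off the
    branch of [b] is at depth at most the radius minus the depth of [z]. Were
    [z] strictly below [b], the eccentricity of [b] would be less than the
    radius; so [z] is [b]. If two children were centers, no vertex at all would
    have depth equal to the radius, and the eccentricity of the root would be
    too small. *)
Lemma center_unique z z' :
  0 < radius G -> (forall u, dep u <= radius G) ->
  z != x -> eccentricity z <= radius G ->
  z' != x -> eccentricity z' <= radius G -> z = z'.
Proof.
have [dep_root _ dep_par _] := rootG.
move=> r_gt0 dep_r.
have outside z1 b w : par b = x -> fconnect par z1 b -> eccentricity z1 <= radius G ->
    ~~ fconnect par w b -> dep z1 + dep w <= radius G.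
  move=> pb zb ez wb; apply: leq_trans ez.
  apply: leq_trans (dist_le_eccentricity z1 w).
  have [p [zp lp <-]] := dist_walk (conG z1 w); rewrite -lp.
  by apply: (walk_across_root pb zb) zp; rewrite lp.
have child z1 : z1 != x -> eccentricity z1 <= radius G -> par z1 = x.
  move=> z1x ez; have [b [bx pb zb]] := top_ancestor rootG z1x.
  suff <- : b = z1 by [].
  apply/eqP; rewrite eq_sym -(dep_fconnect rootG zb) eqn_leq.
  have [-> _] := dep_fconnect rootG zb; rewrite (dep_child rootG bx pb) leqNgt.
  apply/negP => z1_gt1.
  suff : eccentricity b < radius G by rewrite ltnNge radius_le_eccentricity.
  rewrite -(prednK r_gt0) ltnS; apply/bigmax_leqP => w _.
  have := dep_child rootG bx pb.
  have [wb|wb] := boolP (fconnect par w b).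
    by have := dist_ancestor wb; have := dep_r w; lia.
  have b_x : edge b x by rewrite -pb (edge_par rootG).
  have := dist_le_edge (conG x w) b_x.
  by have := dist_ancestor (fconnect_root w); have := outside z1 b w pb zb ez wb; lia.
move=> zx ez z'x ez'; apply/eqP/negPn/negP => zz'.
have [pz pz'] := (child z zx ez, child z' z'x ez').
have [dz dz'] := (dep_child rootG zx pz, dep_child rootG z'x pz').
suff : eccentricity x < radius G by rewrite ltnNge radius_le_eccentricity.
rewrite -(prednK r_gt0) ltnS; apply/bigmax_leqP => w _.
have := dist_ancestor (fconnect_root w).
have [wz|/(outside z z w pz (connect0 _ _) ez)] := boolP (fconnect par w z); last lia.
have [wz'|/(outside z' z' w pz' (connect0 _ _) ez')] := boolP (fconnect par w z'); last lia.
by rewrite (fconnect_child rootG wz wz') ?eqxx ?dz in zz'.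
Qed.

(** An automorphism moves the root to a center, and the root can be given a color
    different from that of the only other center. *)
Lemma distinguishable_from_root D (c : G -> 'I_D) :
  2 <= D -> 0 < radius G -> (forall u, dep u <= radius G) ->
  (forall f : G -> G, isomorphism f -> f x = x ->
     (forall u, u != x -> c (f u) = c u) -> forall u, f u = u) ->
  distinguishable D G.
Proof.
move=> D_gt1 r_gt0 dep_r rigid.
have D_gt0 : 0 < D by apply: ltnW.
have other (d : 'I_D) : exists d' : 'I_D, d' != d.
  have [d0|d0] := eqVneq (d : nat) 0.
    by exists (Ordinal D_gt1); rewrite -val_eqE /= d0.
  by exists (Ordinal D_gt0); rewrite -val_eqE /= eq_sym.
have [cx cxP] : exists cx, forall z, z != x -> eccentricity z <= radius G -> c z != cx.
  have [/existsP[z /andP[zx ez]]|/existsPn noz] :=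
      boolP [exists z, (z != x) && (eccentricity z <= radius G)].
    have [d dP] := other (c z); exists d => z' z'x ez'.
    by rewrite (center_unique r_gt0 dep_r z'x ez' zx ez) eq_sym.
  by exists (c x) => z zx ez; have := noz z; rewrite zx ez.
exists (fun u => if u == x then cx else c u) => f isof cf.
have fx : f x = x.
  apply/eqP/negPn/negP => fxx; have := cf x; rewrite eqxx (negbTE fxx).
  apply/eqP/cxP => //; apply: leq_trans (eccentricity_isomorphism x _ isof) _.
    by case: (rooting_tree rootG).
  apply/bigmax_leqP => w _; apply: leq_trans (dep_r w).
  by have := dist_ancestor (fconnect_root w); lia.
apply: rigid => // u ux; have := cf u; rewrite (negbTE ux).
by rewrite -fx (inj_eq (bij_inj isof.1)) (negbTE ux).
Qed.

End Center.

(** * Codes of colored trees *)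

Section Codes.
Variable D : nat.
Hypothesis D_gt0 : 0 < D.

Definition subcode (m k : nat) : bool := odd (m %/ D %/ 2 ^ k).

(** The code with color [c] whose subcodes are the [k < n] that satisfy [P]. *)
Definition mkcode (c n : nat) (P : pred nat) : nat :=
  c + D * \sum_(k < n | P k) 2 ^ k.

(** The numbers below [ncodes h] are the codes of the colored trees of height less
    than [h]: a color and a set of codes of height less than [h.-1]. *)
Fixpoint ncodes (h : nat) : nat := if h is h'.+1 then D * 2 ^ ncodes h' else 0.

Lemma subcode_lt m k : subcode m k -> k < m.
Proof.
rewrite /subcode => mk; apply: leq_trans (ltn_expl k (ltnSn 1)) _.
apply: leq_trans (leq_div m D); rewrite leqNgt; apply: contraTN mk => lt_m.
by rewrite divn_small.
Qed.

Lemma subcode_ncodes h m k : m < ncodes h.+1 -> subcode m k -> k < ncodes h.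
Proof.
rewrite /= mulnC -ltn_divLR // /subcode => lt_m mk.
rewrite -(@ltn_exp2l 2) //; apply: leq_ltn_trans lt_m.
by rewrite leqNgt; apply: contraTN mk => lt_m; rewrite divn_small.
Qed.

Lemma odd_sum_exp2 n (P : pred nat) k :
  odd ((\sum_(i < n | P i) 2 ^ i) %/ 2 ^ k) = (k < n) && P k.
Proof.
elim: n k P => [|n IH] k P; first by rewrite big_ord0 div0n.
rewrite big_mkcond big_ord_recl /= -big_mkcond /=.
rewrite (eq_bigr (fun i : 'I_n => 2 * 2 ^ i)) => [|i _]; last by rewrite expnS.
rewrite -big_distrr /=; set s := \sum_(i < n | _) _.
case: k => [|k].
  by rewrite expn0 divn1 oddD oddM addbF; case: (P 0).
rewrite expnS divnMA divnDr ?dvdn_mulr // mulKn //.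
have -> : (if P 0 then 2 ^ 0 else 0) %/ 2 = 0 by case: (P 0).
by rewrite add0n (IH k (fun i => P i.+1)).
Qed.

Lemma exp2_sum_lt n (P : pred nat) : \sum_(i < n | P i) 2 ^ i < 2 ^ n.
Proof.
apply: (@leq_ltn_trans (\sum_(i < n) 2 ^ i)).
  by rewrite [leqLHS]big_mkcond; apply: leq_sum => i _; case: (P i).
elim: n => [|n IH]; first by rewrite big_ord0.
by rewrite big_ord_recr /= expnS mul2n -addnn -addSn leq_add2r.
Qed.

Lemma subcode_mkcode c n P k : c < D -> subcode (mkcode c n P) k = (k < n) && P k.
Proof.
move=> c_lt; rewrite /subcode /mkcode addnC mulnC divnMDl // (divn_small c_lt) addn0.
exact: odd_sum_exp2.
Qed.

Lemma modn_mkcode c n P : c < D -> mkcode c n P %% D = c.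
Proof. by move=> c_lt; rewrite /mkcode addnC mulnC modnMDl modn_small. Qed.

Lemma mkcode_lt c h P : c < D -> mkcode c (ncodes h) P < ncodes h.+1.
Proof.
move=> c_lt; have := exp2_sum_lt (ncodes h) P; rewrite /mkcode /=.
by set s := bigop _ _ _; nia.
Qed.

(** The quotient by [D] is determined by its bits, which are the subcodes. *)
Lemma code_ext m n : m %% D = n %% D -> subcode m =1 subcode n -> m = n.
Proof.
rewrite /subcode => col bits; rewrite (divn_eq m D) (divn_eq n D) col.
congr (_ * _ + _); move: (m %/ D) (n %/ D) bits => a b.
have [s] := ubnP (a + b); elim: s a b => // s IH a b lt_s bits.
have odd_ab : odd a = odd b by have := bits 0; rewrite !divn1.
have [ab0|ab_gt0] := posnP (a + b); first by lia.
rewrite -(odd_double_half a) -(odd_double_half b) odd_ab (IH a./2 b./2) //.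
  by rewrite -!divn2; lia.
by move=> k; have := bits k.+1; rewrite expnS !divnMA !divn2.
Qed.

End Codes.

(** * Codings of rooted trees *)

(** Nothing is asked of the root: in a branched subgraph, the children of the root
    form an arbitrary set. *)
Definition coding (D : nat) (G : sgraph) (x : G) (par : G -> G) (code : G -> nat) :=
  forall u, u != x -> forall k,
    subcode D (code u) k <-> exists w, [/\ w != x, par w = u & code w = k].

Definition sibling_injective (G : sgraph) (x : G) (par : G -> G) (code : G -> nat) :=
  forall u w, u != x -> w != x -> par u = par w -> code u = code w -> u = w.

Section Coding.
Variables (D r : nat) (G : sgraph) (x : G) (par : G -> G) (dep : G -> nat).
Hypothesis D_gt0 : 0 < D.
Hypothesis rootG : rooting x par dep.
Hypothesis dep_r : forall u, dep u <= r.
Implicit Types (u v w a b : G).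

(** Going up from the leaves, [f] preserves codes, because a code is determined by
    its color and its subcodes, which are the codes of the children. Going down
    from the root, [f] then fixes every vertex, because siblings have different
    codes. *)
Lemma coding_rigid code (f : G -> G) :
  coding D x par code -> sibling_injective x par code ->
  isomorphism f -> f x = x ->
  (forall u, u != x -> code (f u) = code u %[mod D]) ->
  forall u, f u = u.
Proof.
move=> codeP inj_code isof fx col; have fpar := automorphism_par rootG isof fx.
have [_ _ dep_par _] := rootG; have [[g fK gK] _] := isof.
have f_x u : (f u == x) = (u == x) by rewrite -{1}fx (inj_eq (can_inj fK)).
have code_f u : u != x -> code (f u) = code u.
  have [n] := ubnP (r - dep u); elim: n u => // n IH u lt_n ux.
  have child w : w != x -> par w = u -> code (f w) = code w.
    move=> wx pw; apply: IH => //.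
    by have := dep_par w wx; have := dep_r w; rewrite pw; lia.
  apply: (code_ext D_gt0 (col u ux)) => k; apply/idP/idP.
    rewrite codeP ?f_x // => -[w' []]; rewrite -(gK w') f_x fpar => wx.
    move=> /(can_inj fK) pw; rewrite child // => <-; apply/(codeP u ux).
    by exists (g w').
  move=> /(codeP u ux)[w [wx pw <-]]; apply/codeP; rewrite ?f_x //.
  by exists (f w); rewrite f_x fpar pw child.
elim/(rooting_ind rootG) => // u ux IH.
by apply: inj_code; rewrite ?f_x ?fpar ?IH ?code_f.
Qed.

(** The code of [u] truncated to height less than [h]; for [h] large enough this is
    the code of the whole colored subtree below [u]. *)
Fixpoint code_at (c : G -> nat) (h : nat) (u : G) : nat :=
  if h is h'.+1 then
    mkcode D (c u) (ncodes D h')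
      (fun k => [exists w, [&& w != x, par w == u & code_at c h' w == k]])
  else 0.

Lemma coding_exists (c : G -> nat) :
  (forall u, c u < D) ->
  exists code : G -> nat,
    [/\ forall u, code u = c u %[mod D],
        forall u, code u < ncodes D (r - dep u).+1 &
        forall u k, subcode D (code u) k <->
           exists w, [/\ w != x, par w = u & code w = k]].
Proof.
move=> c_lt; have [_ _ dep_par _] := rootG.
exists (fun u => code_at c (r - dep u).+1 u); split=> [u|u|u k].
- by rewrite /= modn_mkcode // modn_small.
- exact: (mkcode_lt D_gt0).
have child w : w != x -> par w = u -> (r - dep w).+1 = r - dep u.
  by move=> wx pw; have := dep_par w wx; have := dep_r w; rewrite pw; lia.
rewrite [code_at _ _ _]/= (subcode_mkcode D_gt0) //; split.
  case/andP=> _ /existsP[w /and3P[wx /eqP pw /eqP <-]]; exists w.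
  by rewrite child.
case=> w [wx pw <-]; rewrite child //; apply/andP; split.
  by rewrite -(child w) //; apply: (mkcode_lt D_gt0).
by apply/existsP; exists w; rewrite wx pw !eqxx.
Qed.

(** The codes met on the way from [u] up to the root, which itself is left out. *)
Definition word (code : G -> nat) u : seq nat := map code (traject par u (dep u)).

Lemma word_root code : word code x = [::].
Proof. by have [dep_root _ _ _] := rootG; rewrite /word dep_root. Qed.

Lemma word_cons code u : u != x -> word code u = code u :: word code (par u).
Proof. by have [_ _ dep_par _] := rootG => ux; rewrite /word dep_par. Qed.

Lemma size_word code u : size (word code u) = dep u.
Proof. by rewrite size_map size_traject. Qed.

Lemma word_inj code : sibling_injective x par code -> injective (word code).
Proof.
move=> inj_code u; elim/(rooting_ind rootG): u => [|u ux IH] w.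
  by have [->//|wx] := eqVneq w x; rewrite word_root (word_cons _ wx).
have [->|wx] := eqVneq w x; first by rewrite word_root (word_cons _ ux).
by rewrite (word_cons _ ux) (word_cons _ wx) => -[cuw /IH puw]; apply: inj_code.
Qed.

End Coding.

(** * Siblings with the same code can be exchanged *)

Section Swap.
Variables (D : nat) (G : sgraph) (x : G) (par : G -> G) (dep : G -> nat).
Variable code : G -> nat.
Hypothesis rootG : rooting x par dep.
Hypothesis codeP : coding D x par code.
Implicit Types (u v w a b : G).

Local Notation wd := (word par dep code).
Local Notation below a u := (fconnect par u a).

Let dep_par u : u != x -> dep u = (dep (par u)).+1.
Proof. by case: rootG => _ _ + _; apply. Qed.

Lemma below_neq_root a u : a != x -> below a u -> u != x.
Proof.
by move=> ax; apply: contraTneq => ->; rewrite (root_fconnect rootG) eq_sym.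
Qed.

Lemma eq_word_dep u w : wd u = wd w -> dep u = dep w.
Proof. by move/(congr1 size); rewrite !size_word. Qed.

Lemma eq_word_par u w :
  u != x -> w != x -> wd u = wd w -> code u = code w /\ wd (par u) = wd (par w).
Proof.
by move=> ux wx; rewrite (word_cons rootG _ ux) (word_cons rootG _ wx) => -[].
Qed.

(** Equal codes have the same subcodes, so that a descent below [a] can be copied
    below [b], one step at a time. *)
Lemma twin_exists a b u :
  a != x -> b != x -> wd a = wd b -> below a u ->
  exists2 u', below b u' & wd u' = wd u.
Proof.
move=> ax bx wab; elim/(rooting_ind rootG): u => [|u ux IH].
  by move/(below_neq_root ax); rewrite eqxx.
rewrite par_fconnectE => /predU1P[->|pua]; first by exists b.
have [p pb wp] := IH pua.
have [px pux] := (below_neq_root bx pb, below_neq_root ax pua).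
have [cp _] := eq_word_par px pux wp.
have : subcode D (code p) (code u) by rewrite cp; apply/codeP => //; exists u.
case/(codeP px) => u' [u'x pu' cu']; exists u'.
  by rewrite par_fconnectE pu' pb orbT.
by rewrite (word_cons rootG _ ux) (word_cons rootG _ u'x) cu' pu' wp.
Qed.

(** Going down from [b], the word prescribes the code of the next vertex at each
    step, and only one child has that code. *)
Lemma twin_unique b u w :
  b != x ->
  (forall v v', v != x -> v' != x -> par v = par v' -> code v = code v' ->
     dep b < dep v -> v = v') ->
  below b u -> below b w -> wd u = wd w -> u = w.
Proof.
move=> bx deep; elim/(rooting_ind rootG): u w => [w|u ux IH w ub wb wuw].
  by move/(below_neq_root bx); rewrite eqxx.
have duw := eq_word_dep wuw; have wx := below_neq_root bx wb.
have [eub|nub] := eqVneq u b.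
  by move/eqP: duw; rewrite eub (eq_leqif (dep_fconnect rootG wb)) eq_sym => /eqP.
have lt_u : dep b < dep u.
  by rewrite ltn_neqAle (eq_leqif (dep_fconnect rootG ub)) nub (dep_fconnect rootG ub).
have nwb : w != b by apply: contraTneq lt_u => ewb; rewrite duw ewb ltnn.
have [cuw wp] := eq_word_par ux wx wuw.
move: ub wb; rewrite (par_fconnectE par u) (par_fconnectE par w).
rewrite (negbTE nub) (negbTE nwb) /= => ub wb.
by apply: deep => //; apply: IH.
Qed.

(** Take two siblings with the same code such that deeper siblings have different
    codes. Below each of them a vertex is determined by its word, and the same
    words occur below both. Exchanging the vertices that have the same word is
    the required automorphism. *)
Lemma swap_twins a b :
  a != b -> a != x -> b != x -> par a = par b -> code a = code b ->
  (forall v v', v != x -> v' != x -> par v = par v' -> code v = code v' ->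
     dep a < dep v -> v = v') ->
  exists f : G -> G, [/\ isomorphism f, f a != a & forall u, code (f u) = code u].
Proof.
move=> ab ax bx pab cab deep.
have dab : dep a = dep b by rewrite (dep_par ax) (dep_par bx) pab.
have wab : wd a = wd b by rewrite (word_cons rootG _ ax) (word_cons rootG _ bx) cab pab.
have disj u : below a u -> below b u -> False.
  by move=> ua ub; rewrite (fconnect_child rootG ua ub dab) eqxx in ab.
pose f u := odflt u [pick u' | (below a u && below b u' || below b u && below a u')
                               && (wd u' == wd u)].
have fa u : below a u -> below b (f u) /\ wd (f u) = wd u.
  move=> ua; rewrite /f ua; case: pickP => [u' /andP[/orP[/= u'b|/andP[ub]] /eqP //]|].
    by case: (disj u).
  have [u' u'b wu'] := twin_exists ax bx wab ua.
  by move/(_ u'); rewrite u'b wu' eqxx.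
have fb u : below b u -> below a (f u) /\ wd (f u) = wd u.
  move=> ub; rewrite /f ub; case: pickP => [u' /andP[/orP[/andP[ua]|/= u'a] /eqP //]|].
    by case: (disj u).
  have [u' u'a wu'] := twin_exists bx ax (esym wab) ub.
  by move/(_ u'); rewrite u'a wu' eqxx orbT.
have fo u : ~~ below a u -> ~~ below b u -> f u = u.
  by rewrite /f => /negbTE-> /negbTE->; case: pickP.
have uniq_a u w : below a u -> below a w -> wd u = wd w -> u = w.
  exact: twin_unique.
have uniq_b u w : below b u -> below b w -> wd u = wd w -> u = w.
  by apply: twin_unique; rewrite -?dab.
have ff u : f (f u) = u.
  have [/[dup] ua /fa[ub wu]|ua] := boolP (below a u).
    by have [ua' wu'] := fb _ ub; apply: uniq_a; rewrite ?wu'.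
  have [/[dup] ub /fb[ua' wu]|ub] := boolP (below b u).
    by have [ub' wu'] := fa _ ua'; apply: uniq_b; rewrite ?wu'.
  by rewrite !fo // fo.
have wf u : wd (f u) = wd u.
  have [/fa[]//|ua] := boolP (below a u); have [/fb[]//|ub] := boolP (below b u).
  by rewrite fo.
have f_x : f x = x by apply: fo; rewrite (root_fconnect rootG) eq_sym.
have fx u : (f u == x) = (u == x) by rewrite -{1}f_x (inj_eq (can_inj ff)).
have fab : f a = b by have [? _] := fa a (connect0 _ _); apply: uniq_b; rewrite ?wf.
have fba : f b = a by rewrite -fab ff.
have npa : f (par a) = par a.
  have par_out z : z != x -> dep z = dep a -> ~~ below z (par a).
    move=> zx dz; apply/negP => /(dep_fconnect rootG)[]; rewrite dz (dep_par ax); lia.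
  by apply: fo; apply: par_out.
have fpar u : par (f u) = f (par u).
  have [->|ux] := eqVneq u x; first by have [_ p _ _] := rootG; rewrite f_x p f_x.
  have [->|ua] := eqVneq u a; first by rewrite fab npa.
  have [->|ub] := eqVneq u b; first by rewrite fba -pab npa.
  have [_ wp] : code (f u) = code u /\ wd (par (f u)) = wd (par u).
    by apply: eq_word_par; rewrite ?fx.
  have belowE z : u != z -> below z u = below z (par u).
    by move=> uz; rewrite par_fconnectE (negbTE uz).
  have [pa|pa] := boolP (below a (par u)).
    have /fa[fub _] : below a u by rewrite belowE.
    apply: uniq_b (fa _ pa).1 _; last by rewrite wp wf.
    by move: fub; rewrite par_fconnectE -{1}fab (inj_eq (can_inj ff)) (negbTE ua).
  have [pb|pb] := boolP (below b (par u)).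
    have /fb[fua _] : below b u by rewrite belowE.
    apply: uniq_a (fb _ pb).1 _; last by rewrite wp wf.
    by move: fua; rewrite par_fconnectE -{1}fba (inj_eq (can_inj ff)) (negbTE ub).
  by rewrite !fo ?belowE.
exists f; split.
- split; first by exists f.
  exact: rooting_mono rootG rootG (can_inj ff) f_x fpar.
- by rewrite fab eq_sym.
- move=> u; have [->|ux] := eqVneq u x; first by rewrite f_x.
  by have [] := @eq_word_par (f u) u _ ux (wf u); rewrite ?fx.
Qed.

End Swap.

(** A deepest pair of distinct siblings with the same code could be exchanged. *)
Lemma distinguishing_sibling_injective D (G : sgraph) (x : G) par dep
    (c : G -> 'I_D) code :
  rooting x par dep -> coding D x par code ->
  (forall u, code u = c u %[mod D]) ->
  (forall f : G -> G, isomorphism f -> (forall v, c (f v) = c v) -> forall v, f v = v) ->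
  sibling_injective x par code.
Proof.
move=> rootG codeP codec rigid.
pose r := \max_u dep u; have dep_r u : dep u <= r by apply: leq_bigmax.
move=> a b; have [n] := ubnP (r - dep a); elim: n a b => // n IH a b lt_n ax bx pab cab.
apply/eqP/negPn/negP => ab.
have [|f [isof fa cf]] := swap_twins rootG codeP ab ax bx pab cab.
  move=> v v' vx v'x pv cv lt_v; apply: IH => //.
  by have := dep_r v; lia.
case/eqP: fa; apply: rigid => // v; apply: val_inj.
by have := codec (f v); rewrite cf codec !modn_small.
Qed.

(** * The tree unfolding a code *)

Section CodeTree.
Variables D rho : nat.

(** The deepest letter comes first, and [rho] is the code of the empty word. *)
Fixpoint is_descent (s : seq nat) : bool :=
  if s is k :: s' then subcode D (head rho s') k && is_descent s' else true.

(** Subcodes are smaller than their codes, hence a descent from [rho] is a word of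
    length at most [rho] in letters less than [rho]: the descents can be
    enumerated, and form a finite type. *)
Fixpoint words (n : nat) : seq (seq nat) :=
  if n is n'.+1 then
    [::] :: [seq k :: s | k <- iota 0 rho, s <- words n']
  else [:: [::]].

Lemma mem_words n s :
  (s \in words n) = (size s <= n) && all (fun k => k < rho) s.
Proof.
elim: n s => [|n IH] [|k s] //=; rewrite inE /=.
apply/allpairsP/idP => [[[k' s'] [/=]]|].
  rewrite mem_iota add0n IH => k'_lt /andP[sz lt_s] [-> ->].
  by rewrite ltnS sz lt_s andbT.
rewrite ltnS => /and3P[sz k_lt lt_s].
by exists (k, s); rewrite mem_iota IH sz lt_s k_lt.
Qed.

Definition descents : seq (seq nat) := [seq s <- words rho | is_descent s].

Lemma mem_descents s : (s \in descents) = is_descent s.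
Proof.
rewrite mem_filter mem_words; apply: andb_idr => desc.
suff /andP[sz ->] : (head rho s + size s <= rho) && all (fun k => k < rho) s.
  by rewrite andbT (leq_trans _ sz) ?leq_addl.
elim: s desc => [|k s IH] /=; first by rewrite addn0 leqnn.
case/andP=> /(subcode_lt (D := D)) k_lt /IH/andP[sz ->].
have -> : k + (size s).+1 <= rho by rewrite addnS -addSn (leq_trans _ sz) // leq_add2r.
by rewrite (leq_trans k_lt) // (leq_trans _ sz) ?leq_addr.
Qed.

Definition code_vertex : finType := seq_sub descents.

Definition descent_of (s : code_vertex) : seq nat := ssval s.

Lemma descent_of_inj : injective descent_of. Proof. exact: val_inj. Qed.

Lemma descent_ofP s : is_descent (descent_of s).
Proof. by rewrite -mem_descents; apply: ssvalP. Qed.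

Lemma code_root_subproof : [::] \in descents. Proof. by rewrite mem_descents. Qed.

Definition code_root : code_vertex := SeqSub code_root_subproof.

Lemma code_parent_subproof (s : code_vertex) : behead (descent_of s) \in descents.
Proof.
by have := descent_ofP s; rewrite mem_descents; case: (descent_of s) => //= k s' /andP[].
Qed.

Definition code_parent s : code_vertex := SeqSub (code_parent_subproof s).

Definition label (s : code_vertex) : nat := head rho (descent_of s).

Lemma descent_of_cons s :
  s != code_root -> descent_of s = label s :: descent_of (code_parent s).
Proof. by case: s => -[|k t] Ps; rewrite -val_eqE. Qed.

Lemma subcode_label s :
  s != code_root -> subcode D (label (code_parent s)) (label s).
Proof.
by move/descent_of_cons => Es; have := descent_ofP s; rewrite Es => /andP[].
Qed.

Definition code_edge : rel code_vertex :=
  fun s t =>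
    (s != code_root) && (code_parent s == t) || (t != code_root) && (code_parent t == s).

Lemma code_edge_sym : symmetric code_edge.
Proof. by move=> s t; rewrite /code_edge orbC. Qed.

Lemma code_edge_irrefl : irreflexive code_edge.
Proof.
case=> -[|k t] Ps; rewrite /code_edge orbb -!val_eqE //=.
by apply/negbTE/eqP => /(congr1 size) /=; lia.
Qed.

Definition code_tree : sgraph := SGraph code_edge_sym code_edge_irrefl.

Lemma code_rooting : @rooting code_tree code_root code_parent (fun s => size (descent_of s)).
Proof.
split=> //; first exact: val_inj.
by move=> s /descent_of_cons ->.
Qed.

Lemma code_ncodes h s :
  0 < D -> rho < ncodes D h.+1 -> is_descent s ->
  size s <= h /\ head rho s < ncodes D (h - size s).+1.
Proof.
move=> D_gt0 rho_lt; elim: s => [|k s IH] /=; first by rewrite subn0.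
case/andP=> ks /IH[sz hd_lt].
have := subcode_ncodes D_gt0 hd_lt ks.
case e : (h - size s) => [|m] // k_lt.
have -> : h - (size s).+1 = m by lia.
by split=> //; lia.
Qed.

End CodeTree.

(** * The universal tree *)

Section Universal.
Variables D r : nat.
Hypothesis D_gt0 : 0 < D.

(** All codes of height less than [r] are subcodes. The color is arbitrary. *)
Definition full_code : nat := mkcode D 0 (ncodes D r) predT.

Lemma subcode_full_code k : subcode D full_code k = (k < ncodes D r).
Proof. by rewrite /full_code (subcode_mkcode D_gt0) // andbT. Qed.

Local Notation T := (code_tree D full_code).
Local Notation root := (code_root D full_code : T).
Local Notation rootT := (code_rooting D full_code).

(** The map that sends a vertex to its word commutes with parents, and every
    descent that extends the word of a vertex other than the root comes from a
    child of that vertex; hence the image is a branched subgraph. *)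
Lemma distinguishable_embeds (U : sgraph) (x : U) par dep :
  rooting x par dep -> (forall u, dep u <= r) -> distinguishable D U ->
  exists S : {set T}, branched_subgraph root S /\ isomorphic U (induced S).
Proof.
move=> rootU dep_r [c rigid]; have [_ par_root dep_par _] := rootU.
have [code [codec code_lt codeP]] :=
  coding_exists D_gt0 rootU dep_r (fun u => ltn_ord (c u)).
have codeP' : coding D x par code by move=> u _; apply: codeP.
have inj_code := distinguishing_sibling_injective rootU codeP' codec rigid.
pose wd := word par dep code.
have wd_inj : injective wd := word_inj rootU inj_code.
have wd_cons u : u != x -> wd u = code u :: wd (par u) := word_cons rootU code (u := u).
have wd_root : wd x = [::] := word_root rootU code.
have desc_wd u : wd u \in descents D full_code.
  rewrite mem_descents; elim/(rooting_ind rootU): u => [|u ux IH].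
    by rewrite wd_root.
  rewrite wd_cons //= IH andbT; have [pux|pux] := eqVneq (par u) x.
    rewrite pux wd_root /= subcode_full_code; apply: leq_trans (code_lt u) _.
    have := dep_r u; rewrite (dep_par u ux) pux; have [-> _ _ _] := rootU.
    by move=> r_gt0; rewrite -subSn // subSS subn0.
  by rewrite (wd_cons (par u)) //=; apply/codeP; exists u.
pose phi u : T := SeqSub (desc_wd u).
have phi_inj : injective phi by move=> u w /(congr1 (@descent_of _ _)) /wd_inj.
have phi_root : phi x = root by apply: val_inj; rewrite /= wd_root.
have phi_par u : code_parent (phi u) = phi (par u).
  apply: val_inj => /=; have [->|ux] := eqVneq u x; first by rewrite par_root wd_root.
  by rewrite wd_cons.
pose S : {set T} := [set phi u | u : U].
have S_phi u : phi u \in S by apply: imset_f.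
exists S; split.
  apply/(branched_subgraphE rootT); split; first by rewrite -phi_root.
  move=> t ptx; apply/idP/idP => [/imsetP[u _ ->]|]; first by rewrite phi_par.
  case/imsetP => p _ ep.
  have px : p != x by apply: contraNneq ptx => px; rewrite ep px phi_root.
  have := descent_ofP t; have := congr1 (@descent_of _ _) ep => /=.
  case et: (descent_of t) => [|k s] /=; first by rewrite wd_cons.
  move=> es; rewrite es wd_cons //= => /andP[/codeP[w [wx pw cw]] _].
  suff -> : t = phi w by [].
  by apply: descent_of_inj; rewrite et es -[RHS]/(wd w) (wd_cons w wx) cw pw.
exists (fun u => Sub (phi u) (S_phi u)); split; last first.
  exact: rooting_mono rootU rootT phi_inj phi_root phi_par.
apply: inj_card_bij; first by move=> u w /(congr1 val) /phi_inj.
by rewrite card_sig card_imset.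
Qed.

(** The first letters of the words are a coding, with their remainders modulo [D] as
    colors. *)
Lemma branched_distinguishable (S : {set T}) :
  1 < D -> 0 < r -> branched_subgraph root S -> radius (induced S) = r ->
  distinguishable D (induced S).
Proof.
move=> D_gt1 r_gt0 /(branched_subgraphE rootT)[xS closS] radS.
have full_lt : full_code < ncodes D r.+1 by apply: (mkcode_lt D_gt0).
have parS t : t \in S -> code_parent t \in S.
  move=> tS; have [->//|px] := eqVneq (code_parent t) root.
  by rewrite -closS.
have rootS := induced_rooting rootT xS parS.
pose code (t : induced S) := label (val t).
have dep_r (t : induced S) : size (descent_of (val t)) <= r.
  have := descent_ofP (val t).
  by case/(code_ncodes D_gt0 full_lt).
pose c (t : induced S) := Ordinal (ltn_pmod (code t) D_gt0).
apply: (distinguishable_from_root rootS (c := c)); rewrite ?radS //.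
move=> f isof fx fc.
apply: (coding_rigid (r := r) D_gt0 rootS _ _ _ isof fx (code := code)) => //.
- move=> t tx k; split=> [tk|[w [wx <- <-]]].
    have ks : k :: ssval (val t) \in descents D full_code.
      by rewrite mem_descents /= descent_ofP andbT.
    pose w : T := SeqSub ks.
    have pw : code_parent w = val t by apply: val_inj.
    have wS : w \in S by rewrite closS pw ?(valP t).
    by exists (Sub w wS); split=> //; apply: val_inj.
  by apply: (subcode_label (s := val w)); rewrite -(inj_eq val_inj) in wx.
- move=> t w; rewrite -!(inj_eq val_inj) => tx wx /(congr1 val) ptw ctw.
  apply/val_inj/descent_of_inj; rewrite (descent_of_cons tx) (descent_of_cons wx).
  by rewrite -[label _]/(code t) ctw; congr (_ :: descent_of _).
- by move=> t tx; apply: (congr1 val (fc t tx)).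
Qed.

End Universal.

Theorem theorem8 (D r : nat) (hD : 2 <= D) (hr : 0 < r) :
  exists (T : sgraph) (x : T),
    [/\ is_tree T,
        forall U : sgraph,
          is_tree U -> distinguishable D U -> radius U <= r ->
          exists S : {set T}, branched_subgraph x S /\ isomorphic U (induced S)
      & 2 <= r ->
        forall S : {set T},
          branched_subgraph x S -> radius (induced S) = r ->
          distinguishable D (induced S)].
Proof.
have D_gt0 : 0 < D by apply: ltnW.
exists (code_tree D (full_code D r)), (code_root D (full_code D r)); split.
- exact: rooting_tree (code_rooting _ _).
- move=> U treeU distU radU.
  have [x ecc_x] := eccentricity_le_radius treeU.1.1.
  have [par rootU] := tree_rooting x treeU.
  apply: distinguishable_embeds rootU _ distU => // u.
  by apply: leq_trans radU; apply: leq_trans ecc_x; apply: dist_le_eccentricity.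
- by move=> _ S; apply: branched_distinguishable.
Qed.
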